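(* Let $(\theta_i)_{i\ge1}$ be positive numbers with $\sum_{i=1}^\infty\theta_i=1$, and let $$w(x,y):=\sum_{i=1}^\infty\theta_i\,1_{[i,i+1)}(x)\,1_{[i,i+1)}(y),\qquad (x,y)\in\mathbb R^2,$$ with marginals $w_X(x)=\int w(x,y)\,dy$, $w_Y(y)=\int w(x,y)\,dx$. Let $(f_i)_{i\ge2}$ be real numbers with $\sum_{i\ge2}|f_i|\theta_i<\infty$ and $\sum_{i\ge2}|f_i|^2\theta_i=\infty$, put $f_1:=-\frac1{\theta_1}\sum_{i=2}^\infty f_i\theta_i$, and define $f(x):=\sum_{i=1}^\infty f_i\,1_{[i,i+1)}(x)$ and $g(y):=-f(y)$. Then $f(x),g(y)\in\mathcal L^1(w)$, $f(x),g(y)\notin\mathcal L^2(w)$, $f(x)+g(y)\in\mathcal L^2(w)$, and $(f,g)$ solves the system $$f(x)w_X(x)+\int g(y)w(x,y)\,dy=0,\qquad g(y)w_Y(y)+\int f(x)w(x,y)\,dx=0,\qquad \int g(y)w_Y(y)\,dy=0 .$$ In particular, this system has a non-trivial solution besides $f=g=0$, so its solution is not unique. Moreover, for this $w$ one has $\int w_X^2w_Y^2/w\,dx\,dy=\infty$ (the integrand being understood as $+\infty$ where $w=0$ and $w_Xw_Y>0$).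
   Context: $\mathcal L^r(w)$ ($r\ge1$) denotes the measurable functions $h$ on $\mathbb R^2$ with $\int|h|^r w\,dx\,dy<\infty$ (modulo equality $w$-a.e.); functions $f(x)$, $g(y)$ of one variable are regarded as functions on $\mathbb R^2$. *)

(* Defs.v *)
From HB Require Import structures.
From mathcomp Require Import all_boot all_order all_algebra.
From mathcomp Require Import all_classical all_reals all_analysis.

Set Implicit Arguments.
Unset Strict Implicit.
Unset Printing Implicit Defensive.

Import Order.TTheory GRing.Theory Num.Theory.
Import numFieldNormedType.Exports.

Local Open Scope classical_set_scope.
Local Open Scope ring_scope.
Local Open Scope ereal_scope.

Notation leb R := (@lebesgue_measure R).
Notation leb2 R := (@lebesgue_measure R \x @lebesgue_measure R)%E.

(* A weight on R^2 is a function to [0, +oo], so that its integrals and those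
   of nonnegative functions against it always make sense in \bar R. *)

Definition margX (R : realType) (w : R * R -> \bar R) (x : R) : \bar R :=
  \int[leb R]_y w (x, y).

Definition margY (R : realType) (w : R * R -> \bar R) (y : R) : \bar R :=
  \int[leb R]_x w (x, y).

(* The representatives of the classes in L^r(w); the identification of these
   representatives is [eqW] below. *)
Definition LrW (R : realType) (w : R * R -> \bar R) (r : R) :
    set (R * R -> R) :=
  [set h : measurableTypeR R * measurableTypeR R -> R |
    measurable_fun setT h /\
    \int[leb2 R]_z ((`|h z| `^ r)%R%:E * w z) < +oo].

(* Equality outside a null set of the measure w dx dy. *)
Definition eqW (R : realType) (w : R * R -> \bar R) (h1 h2 : R * R -> R) :
    Prop :=
  exists N : set (measurableTypeR R * measurableTypeR R),
    [/\ measurable N, \int[leb2 R]_(z in N) w z = 0 &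
        forall z, ~ N z -> h1 z = h2 z].

(* In the Lebesgue integral on \bar R, +oo - oo = -oo, and likewise for the
   sum of two extended reals; hence each equation also asserts that its
   integral converges absolutely. *)
Definition solves (R : realType) (w : R * R -> \bar R) (f g : R -> R) : Prop :=
  [/\ forall x, (f x)%:E * margX w x + \int[leb R]_y ((g y)%:E * w (x, y)) = 0,
      forall y, (g y)%:E * margY w y + \int[leb R]_x ((f x)%:E * w (x, y)) = 0 &
      \int[leb R]_y ((g y)%:E * margY w y) = 0].

Definition cell (R : realType) (i : nat) : set R := `[i%:R, i.+1%:R[.

Definition blockW (R : realType) (theta : nat -> R) (z : R * R) : \bar R :=
  \sum_(1 <= i <oo) (theta i * \1_(@cell R i) z.1 * \1_(@cell R i) z.2)%:E.

(* The partial sums are eventually constant at each x. *)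
Definition stepF (R : realType) (a : nat -> R) (x : R) : R :=
  \big[+%R/0%R]_(1 <= i <oo) (a i * \1_(@cell R i) x)%R.

(* Main.v *)
(** Every integrand factors through a measurable map into nat. For all but the
    last integral the fibres over the positive integers have measure 1 and the
    integrand vanishes on the fibre over 0: the map is x |-> truncn x on the
    line, and on the plane z |-> i if z lies in the diagonal square
    [i, i+1) x [i, i+1), 0 if there is none. These integrals thus become series:
    int |f|^r w and int |g|^r w are sum |f_i|^r theta_i, while f(x) + g(y)
    vanishes on the support of w. In the last integral w vanishes on
    [1, 2) x [2, 3), where the marginals do not. *)

Require Import Defs.
From HB Require Import structures.
From mathcomp Require Import all_boot all_order all_algebra.
From mathcomp Require Import all_classical all_reals all_analysis.
From mathcomp Require Import measurable_realfun.

Set Implicit Arguments.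
Unset Strict Implicit.
Unset Printing Implicit Defensive.

Import Order.TTheory GRing.Theory Num.Theory.
Import numFieldNormedType.Exports.

Local Open Scope classical_set_scope.
Local Open Scope ring_scope.
Local Open Scope ereal_scope.

(** * Integrals of functions of a natural-number label *)

Section integral_of_nat_label.
Context {d} {T : measurableType d} {R : realType}.
Variable mu : {measure set T -> \bar R}.

(** Singletons suffice because [nat] is countable: any preimage is a countable union of fibres. *)
Lemma measurable_fun_nat (phi : T -> nat) :
  (forall k, measurable (phi @^-1` [set k])) -> measurable_fun setT phi.
Proof.
move=> mphi _ Y _; rewrite setTI.
have -> : phi @^-1` Y = \bigcup_(k in Y) phi @^-1` [set k].
  by apply/seteqP; split=> [x Yx|x [k Yk /= ->]//]; exists (phi x).
by apply: bigcup_measurable => k _; exact: mphi.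
Qed.

Variables (phi : T -> nat) (mphi : measurable_fun setT phi).

Lemma measurable_fiber k : measurable (phi @^-1` [set k]).
Proof. by rewrite -[X in measurable X]setTI; exact: mphi. Qed.

Lemma measurable_fun_comp_nat d' (U : measurableType d') (h : nat -> U) :
  measurable_fun setT (h \o phi).
Proof. exact: (@measurableT_comp _ _ _ _ _ _ h). Qed.

Lemma bigcup_fiber : \bigcup_k phi @^-1` [set k] = [set: T].
Proof. by apply/seteqP; split=> // x _; exists (phi x). Qed.

Lemma trivIset_fiber : trivIset setT (fun k => phi @^-1` [set k]).
Proof. by move=> i j _ _ [x [/= <- <-]]. Qed.

Lemma integral_fiber (h : nat -> \bar R) k :
  \int[mu]_(x in phi @^-1` [set k]) h (phi x) = h k * mu (phi @^-1` [set k]).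
Proof.
rewrite -integral_cst; last exact: measurable_fiber.
by apply: eq_integral => x; rewrite inE => /= ->.
Qed.

Lemma ge0_integral_comp_nat (h : nat -> \bar R) : (forall k, 0 <= h k) ->
  \int[mu]_x h (phi x) = \sum_(0 <= k <oo) h k * mu (phi @^-1` [set k]).
Proof.
move=> h0; rewrite -bigcup_fiber ge0_integral_bigcup//.
- by apply: eq_eseriesr => k _; exact: integral_fiber.
- exact: measurable_fiber.
- by rewrite bigcup_fiber; exact: (measurable_fun_comp_nat h).
- exact: trivIset_fiber.
Qed.

Hypothesis mu_fiber : forall k, (0 < k)%N -> mu (phi @^-1` [set k]) = 1.

Lemma ge0_integral_unit_fibers (h : nat -> \bar R) :
  h 0%N = 0 -> (forall k, 0 <= h k) ->
  \int[mu]_x h (phi x) = \sum_(1 <= k <oo) h k.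
Proof.
move=> h00 h0; rewrite ge0_integral_comp_nat// nneseries_recl//; last first.
  by move=> k _; exact: mule_ge0.
(* The fibre over 0 may have infinite measure; its term still vanishes, since 0 * +oo = 0. *)
rewrite h00 mul0e add0e; apply/congr_lim/funext => n /=.
by apply: eq_big_nat => k /andP[k1 _]; rewrite mu_fiber// mule1.
Qed.

(** Values of both signs require integrability before the integral is split over the fibres; the
    nonnegative case applied to [|v k|] supplies it. *)
Lemma integral_unit_fibers (v : nat -> R) : v 0%N = 0%R ->
  \sum_(1 <= k <oo) `|v k|%:E < +oo ->
  \int[mu]_x (v (phi x))%:E = \sum_(0 <= k <oo) (v k)%:E.
Proof.
move=> v0 vfin; rewrite -bigcup_fiber integral_bigcup.
- apply: eq_eseriesr => k _; rewrite (integral_fiber (EFin \o v)) /=.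
  by case: k => [|k]; [rewrite v0 mul0e|rewrite mu_fiber// mule1].
- exact: trivIset_fiber.
- exact: measurable_fiber.
- rewrite bigcup_fiber; apply/integrableP; split.
    exact: (measurable_fun_comp_nat (EFin \o v)).
  by rewrite (ge0_integral_unit_fibers (h := fun k => `|v k|%:E))// v0 normr0.
Qed.

End integral_of_nat_label.

(** * Series with at most one non-zero term *)

Lemma lim_big_delta {R : realType} m (i : nat) (x : R) :
  \big[+%R/0%R]_(m <= k <oo) (if k == i then x else 0%R) =
  if (m <= i)%N then x else 0%R.
Proof.
apply: lim_near_cst => //; near=> n.
rewrite -big_mkcond big_nat1_eq; congr (if _ then _ else _).
have -> : (i < n)%N by near: n; exact: nbhs_infty_gt.
by rewrite andbT.
Unshelve. all: by end_near. Qed.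

Lemma eseries_delta {R : realType} m (i : nat) (x : \bar R) :
  \sum_(m <= k <oo) (if k == i then x else 0) = if (m <= i)%N then x else 0.
Proof.
apply: lim_near_cst => //; near=> n.
rewrite -big_mkcond big_nat1_eq; congr (if _ then _ else _).
have -> : (i < n)%N by near: n; exact: nbhs_infty_gt.
by rewrite andbT.
Unshelve. all: by end_near. Qed.

(** * Labels of points of the line and of the plane *)

Lemma truncn_fiber {R : realType} k : (0 < k)%N ->
  (fun x : R => Num.truncn x) @^-1` [set k] = @cell R k.
Proof.
move=> k0; apply/seteqP; split=> x; rewrite /cell /= in_itv/=.
  move=> xk; rewrite -truncn_eq ?xk//.
  by rewrite (le_trans ler01)// -truncn_gt0 xk.
exact: truncn_def.
Qed.

Lemma measurable_cell {R : realType} k :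
  measurable (@cell R k : set (measurableTypeR R)).
Proof. exact: measurable_itv. Qed.

Lemma lebesgue_measure_cell {R : realType} k : leb R (cell k) = 1.
Proof.
rewrite /cell lebesgue_measure_itv/= lte_fin ltr_nat ltnSn -EFinB.
by rewrite -natr1 addrAC subrr add0r.
Qed.

Lemma measurable_truncn {R : realType} :
  measurable_fun setT (Num.truncn : measurableTypeR R -> nat).
Proof.
apply: measurable_fun_nat => -[|k]; last first.
  by rewrite truncn_fiber//; exact: measurable_cell.
rewrite (_ : _ @^-1` _ = `]-oo, 1%R[%classic); first exact: measurable_itv.
apply/seteqP; split=> x /=; rewrite in_itv/= ltNge -truncn_gt0.
  by move=> ->.
by rewrite -leqNgt leqn0 => /eqP.
Qed.

Lemma leb_truncn_fiber {R : realType} k : (0 < k)%N ->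
  leb R ((Num.truncn : R -> nat) @^-1` [set k]) = 1.
Proof. by move=> k0; rewrite truncn_fiber// lebesgue_measure_cell. Qed.

(** Coding a pair of indices by one number makes the results on labels available in the plane. This
    label also separates the squares off the diagonal, which the last integral needs. *)
Definition pair_label {R : realType}
    (z : measurableTypeR R * measurableTypeR R) : nat :=
  pickle (Num.truncn (z.1 : R), Num.truncn (z.2 : R)).

Lemma pair_label_fiber {R : realType} i j :
  @pair_label R @^-1` [set pickle (i, j)] =
  (Num.truncn @^-1` [set i]) `*` (Num.truncn @^-1` [set j]).
Proof.
apply/seteqP; split=> -[x y] /=; last by rewrite /pair_label /= => -[-> ->].
by move=> /(pcan_inj pickleK)[].
Qed.

Lemma measurable_pair_label {R : realType} :
  measurable_fun setT (@pair_label R).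
Proof.
apply: measurable_fun_nat => k.
have [[[i j] <-]|nk] := pselect (exists p : nat * nat, pickle p = k).
  rewrite pair_label_fiber.
  by apply: measurableX; apply: measurable_fiber; exact: measurable_truncn.
rewrite (_ : _ @^-1` _ = set0)//.
apply/seteqP; split=> // -[x y] /= xyk; apply: nk.
by exists (Num.truncn (x : R), Num.truncn (y : R)).
Qed.

Lemma leb2_pair_label_fiber {R : realType} i j : (0 < i)%N -> (0 < j)%N ->
  leb2 R (@pair_label R @^-1` [set pickle (i, j)]) = 1.
Proof.
move=> i0 j0; rewrite pair_label_fiber product_measure1E; last 2 first.
- by apply: measurable_fiber; exact: measurable_truncn.
- by apply: measurable_fiber; exact: measurable_truncn.
rewrite [X in X * _]leb_truncn_fiber// [X in _ * X]leb_truncn_fiber//.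
by rewrite mule1.
Qed.

Definition diag_label {R : realType}
    (z : measurableTypeR R * measurableTypeR R) : nat :=
  if Num.truncn (z.1 : R) == Num.truncn (z.2 : R) then Num.truncn (z.1 : R)
  else 0%N.

Lemma measurable_diag_label {R : realType} :
  measurable_fun setT (@diag_label R).
Proof.
(* [h] decodes the pair and compares its entries, so measurability is inherited from
   [pair_label]. *)
pose h k := if unpickle k is Some (i, j) then if i == j :> nat then i else 0%N
            else 0%N.
rewrite (_ : diag_label = h \o pair_label).
  exact: (measurable_fun_comp_nat measurable_pair_label h).
by apply/funext => z; rewrite /h /= pickleK.
Qed.

Lemma diag_label_fiber {R : realType} k : (0 < k)%N ->
  @diag_label R @^-1` [set k] = @pair_label R @^-1` [set pickle (k, k)].
Proof.
move=> k0; rewrite pair_label_fiber; apply/seteqP; split=> -[x y];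
  rewrite /diag_label/=.
  by case: eqP => [<-//|_ k00]; rewrite -k00 in k0.
by move=> [-> ->]; rewrite eqxx.
Qed.

Lemma leb2_diag_label_fiber {R : realType} k : (0 < k)%N ->
  leb2 R (@diag_label R @^-1` [set k]) = 1.
Proof. by move=> k0; rewrite diag_label_fiber// leb2_pair_label_fiber. Qed.

(* Label 0 collects all points outside the cells or the diagonal squares:
   truncn x = 0 for every x < 1, negative x included. *)
Definition zero_at0 {R : realType} (u : nat -> R) (k : nat) : R :=
  if k is 0%N then 0%R else u k.

(** * Step functions and the block weight as functions of labels *)

Lemma indic_cell {R : realType} i (x : R) : (0 < i)%N ->
  \1_(@cell R i) x = (Num.truncn x == i)%:R :> R.
Proof.
move=> i0; rewrite -truncn_fiber// indicE; congr (nat_of_bool _)%:R.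
by apply/idP/eqP; rewrite inE.
Qed.

Lemma stepFE {R : realType} (a : nat -> R) x :
  stepF a x = zero_at0 a (Num.truncn x).
Proof.
have -> : zero_at0 a (Num.truncn x) =
    if (1 <= Num.truncn x)%N then a (Num.truncn x) else 0%R.
  by case: (Num.truncn x).
rewrite -lim_big_delta; congr (limn _); apply/funext => n /=.
apply: eq_big_nat => i /andP[i1 _]; rewrite indic_cell// eq_sym.
by case: eqP => [->|_]; rewrite ?mulr1 ?mulr0.
Qed.

Lemma blockWE {R : realType} (theta : nat -> R) (z : R * R) :
  blockW theta z = (zero_at0 theta (diag_label z))%:E.
Proof.
have -> : (zero_at0 theta (diag_label z))%:E =
    if (1 <= diag_label z)%N then (theta (diag_label z))%:E else 0.
  by case: (diag_label z).
rewrite -eseries_delta; apply/congr_lim/funext => n /=.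
apply: eq_big_nat => i /andP[i1 _]; rewrite !indic_cell// /diag_label.
(* If the truncations agree, both indicators test the same index. If they differ, the label is 0,
   which no i >= 1 equals, and the indicators are not both 1. *)
have [<-|ne] := eqVneq (Num.truncn z.1) (Num.truncn z.2).
  by rewrite (eq_sym i); case: eqP => [->|_]; rewrite ?mulr1 ?mulr0.
rewrite (gtn_eqF i1); case: (Num.truncn z.1 =P i) => [z1i|_]; last first.
  by rewrite mulr0 mul0r.
by rewrite mulr1 -z1i eq_sym (negbTE ne) mulr0.
Qed.

(** * Integration against the block weight *)

Section block_weight.
Context {R : realType} (theta a : nat -> R).
Local Notation w := (blockW theta).
Local Notation c := (zero_at0 theta).
Local Notation b := (zero_at0 a).

Lemma blockW_sym x y : w (x, y) = w (y, x).
Proof.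
by rewrite !blockWE /diag_label /= eq_sym; case: eqP => [->|].
Qed.

(** On the row through x the weight lives on the cell of x, of length 1, so the series over labels
    has one term and converges absolutely whatever the sign of [v]. For x < 1 both sides vanish. *)
Lemma integral_blockW_row (v : nat -> R) x :
  \int[leb R]_y ((v (Num.truncn (y : R)))%:E * w (x, y)) =
  (v (Num.truncn x) * c (Num.truncn x))%:E.
Proof.
pose i := Num.truncn x; pose s := (v i * c i)%R.
pose h k := if k == i then s else 0%R.
have hE k : (h k)%:E = if k == i then s%:E else 0 by rewrite /h; case: ifP.
have h0 : h 0%N = 0%R by rewrite /h /s; case: eqP => // <-; rewrite mulr0.
transitivity (\int[leb R]_y (h (Num.truncn (y : R)))%:E).
  apply: eq_integral => y _.
  rewrite blockWE /diag_label /= -EFinM /h /s /i eq_sym.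
  by case: eqP => [->|_]; rewrite ?mulr0.
rewrite (integral_unit_fibers measurable_truncn (@leb_truncn_fiber R)) //.
  by under eq_eseriesr do rewrite hE; rewrite eseries_delta.
have nE k : `|h k|%:E = if k == i then `|s|%:E else 0.
  by rewrite /h; case: ifP; rewrite ?normr0.
under eq_eseriesr do rewrite nE.
by rewrite eseries_delta; case: ifP; rewrite ltry.
Qed.

Lemma margX_blockW x : margX w x = (c (Num.truncn x))%:E.
Proof.
have := integral_blockW_row (fun=> 1%R) x; rewrite mul1r => <-.
by apply: eq_integral => y _; rewrite mul1e.
Qed.

Lemma margY_blockW y : margY w y = (c (Num.truncn y))%:E.
Proof.
by rewrite -margX_blockW; apply: eq_integral => x _; rewrite blockW_sym.
Qed.

Hypothesis theta_gt0 : forall i, (1 <= i)%N -> (0 < theta i)%R.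

Lemma zero_at0_ge0 k : (0 <= c k)%R.
Proof. by case: k => //= k; exact/ltW/theta_gt0. Qed.

(** The first hypothesis includes the factor [c], so [h] may be arbitrary where the label is 0: the
    weight vanishes there. *)
Lemma integral_powR_blockW r (h : R * R -> R) (F : nat -> R) :
  (forall z, `|h z| `^ r * c (diag_label z) = F (diag_label z))%R ->
  F 0%N = 0%R -> (forall k, 0 <= F k)%R ->
  \int[leb2 R]_z ((`|h z| `^ r)%:E * w z) = \sum_(1 <= k <oo) (F k)%:E.
Proof.
move=> hF F00 F0.
rewrite -(ge0_integral_unit_fibers measurable_diag_label
  (@leb2_diag_label_fiber R) (h := EFin \o F)) /=; last 2 first.
- by rewrite F00.
- by move=> k; rewrite lee_fin.
by apply: eq_integral => z _; rewrite blockWE -EFinM hF.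
Qed.

Lemma measurable_stepF : measurable_fun setT (stepF a : measurableTypeR R -> R).
Proof.
have -> : stepF a = b \o Num.truncn by apply/funext => x; rewrite stepFE.
exact: (measurable_fun_comp_nat measurable_truncn).
Qed.

(** The k-th diagonal square has mass [theta k] > 0, so no null set of the weight contains it. *)
Lemma eqW_blockW (h1 h2 : R * R -> R) k : eqW w h1 h2 -> (0 < k)%N ->
  (forall z, diag_label z = k -> h1 z <> h2 z) -> False.
Proof.
move=> [N [mN N0 h12]] k0 neq.
have kN : diag_label @^-1` [set k] `<=` N.
  by move=> u uk; apply: contrapT => /h12; exact: neq.
have wE : w = (EFin \o c) \o diag_label by apply/funext => u; rewrite blockWE.
have mw : measurable_fun setT
    (w : measurableTypeR R * measurableTypeR R -> \bar R).
  by rewrite wE; exact: (measurable_fun_comp_nat measurable_diag_label).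
have : \int[leb2 R]_(z in diag_label @^-1` [set k]) w z <=
       \int[leb2 R]_(z in N) w z.
  apply: ge0_subset_integral => //.
  - exact: measurable_fiber measurable_diag_label k.
  - exact: measurable_funS mw.
  - by move=> z _; rewrite wE /= lee_fin zero_at0_ge0.
rewrite N0 wE (integral_fiber _ measurable_diag_label (EFin \o c)).
rewrite [X in _ * X]leb2_diag_label_fiber// mule1 /= lee_fin leNgt.
by case: k k0 {neq kN} => // k _ /=; rewrite theta_gt0.
Qed.

Lemma integral_margins_over_blockW :
  \int[leb2 R]_z ((margX w z.1) ^+ 2 * (margY w z.2) ^+ 2 / w z) = +oo.
Proof.
pose H k : \bar R := if unpickle k is Some (i, j) then
  (c i)%:E ^+ 2 * (c j)%:E ^+ 2 / (if i == j :> nat then c i else 0%R)%:E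
  else 0.
have H0 k : 0 <= H k.
  rewrite /H; case: unpickle => [[i j]|//]; rewrite !mule_ge0 ?inve_ge0 //;
    rewrite ?expe_ge0 ?lee_fin ?zero_at0_ge0//.
  by case: ifP => // _; rewrite zero_at0_ge0.
transitivity (\int[leb2 R]_z H (pair_label z)).
  apply: eq_integral => z _.
  rewrite /H pickleK margX_blockW margY_blockW blockWE.
  by rewrite /diag_label; case: ifP.
rewrite (ge0_integral_comp_nat _ measurable_pair_label)//.
(* One infinite term is enough. For cells 1 and 2 the weight is 0, its inverse is +oo, and both
   marginals are positive. *)
apply: (@nneseries_pinfty _ _ _ (pickle (1, 2)%N)) => //.
  by move=> k _; rewrite mule_ge0.
rewrite [X in _ * X]leb2_pair_label_fiber// mule1 /H pickleK /= inve0.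
by rewrite gt0_muley// !mule_gt0// lte_fin theta_gt0.
Qed.

(** * Convergence of the block sums and the system of equations *)

Hypothesis a_L1 : \sum_(2 <= i <oo) (`|a i| * theta i)%:E < +oo.

Lemma is_cvg_sum_blocks :
  cvgn (fun n => \sum_(2 <= i < n) (a i * theta i))%R.
Proof.
have nE i : (2 <= i)%N -> `|a i * theta i|%R = (`|a i| * theta i)%R.
  by move=> i2; rewrite normrM (gtr0_norm (theta_gt0 _))// ltnW.
(* Absolute convergence is used for series starting at 0; the start then returns to 2, where the
   assumed bound applies. *)
rewrite (is_cvg_series_restrict 2 (fun i => a i * theta i)%R).
apply: normed_cvg; rewrite -(is_cvg_series_restrict 2).
apply: nondecreasing_is_cvgn.
  by apply: nondecreasing_series => i _ _; exact: normr_ge0.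
have S0 i : (2 <= i)%N -> true -> 0 <= (`|a i| * theta i)%:E.
  by move=> i2 _; rewrite lee_fin mulr_ge0// ltW// theta_gt0// ltnW.
have Sfin : \sum_(2 <= i <oo) (`|a i| * theta i)%:E \is a fin_num.
  by rewrite ge0_fin_numE//; exact: nneseries_ge0.
(* The finite extended-real sum bounds the nondecreasing real partial sums. *)
exists (fine (\sum_(2 <= i <oo) (`|a i| * theta i)%:E)) => _ [n _ <-].
rewrite -lee_fin fineK//; apply: (le_trans _ (nneseries_lim_ge n S0)).
rewrite sumEFin lee_fin.
by rewrite le_eqVlt; apply/orP; left; apply/eqP/eq_big_nat => i /andP[/nE].
Qed.

Lemma nneseries_recl1 (F : nat -> R) : (forall k, 0 <= F k)%R ->
  \sum_(1 <= k <oo) (F k)%:E = (F 1%N)%:E + \sum_(2 <= k <oo) (F k)%:E.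
Proof.
move=> F0; rewrite (@nneseries_split _ _ 1 1) => [|k _].
  by rewrite big_nat1.
by rewrite lee_fin.
Qed.

Hypothesis a1 : a 1%N = (- ((theta 1%N)^-1 *
  \big[+%R/0%R]_(2 <= i <oo) (a i * theta i)))%R.

(** This is the third equation in series form: [a 1] is chosen so that the first block cancels all
    the others. *)
Lemma sum_blocks_eq0 :
  \sum_(0 <= k <oo) (- (b k * c k))%:E = 0 :> \bar R.
Proof.
pose S n := (\sum_(2 <= i < n) (a i * theta i))%R.
pose s n : \bar R := \sum_(0 <= k < n) (- (b k * c k))%:E.
suff s0 : s @ \oo --> (limn S - limn S)%:E.
  by rewrite (cvg_lim _ s0)// subrr.
(* For n >= 2 the partial sum is exactly [limn S - S n]: the term at 0 vanishes and the term at 1 is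
   [limn S]. *)
apply: (@cvg_trans _ ((fun n => (limn S - S n)%:E) @ \oo)); last first.
  apply: cvg_EFin; first exact: nearW.
  by apply: cvgB; [exact: cvg_cst|exact: is_cvg_sum_blocks].
apply: near_eq_cvg; near=> n.
have n2 : (2 <= n)%N by near: n; exact: nbhs_infty_ge.
rewrite /s sumEFin; congr EFin.
rewrite sumrN (big_cat_nat (leq0n 2) n2)//= opprD; congr (_ - _)%R.
  rewrite big_nat_recr//= big_nat1 mul0r add0r a1 mulNr opprK mulrAC.
  by rewrite mulVf ?mul1r// gt_eqF// theta_gt0.
by apply: eq_big_nat => -[|[]].
Unshelve. all: by end_near. Qed.

(** Serves both the membership of f and g in L^1(w) and the absolute convergence of the third
    integral. *)
Lemma sum_blocks_ltpinfty : \sum_(1 <= k <oo) (`|b k| * c k)%:E < +oo.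
Proof.
rewrite nneseries_recl1 => [|k]; last by rewrite mulr_ge0 ?zero_at0_ge0.
rewrite lte_add_pinfty ?ltry//.
rewrite (_ : limn _ = \sum_(2 <= k <oo) (`|a k| * theta k)%:E)//.
by apply/congr_lim/funext => n; apply: eq_big_nat => -[].
Qed.

(** The first two equations hold for any coefficients, since x and y share a cell wherever the
    weight is non-zero; only the third depends on the value of [a 1]. *)
Lemma solves_blockW : solves w (stepF a) (fun y => - stepF a y)%R.
Proof.
split=> [x|y|].
- under eq_integral do rewrite stepFE.
  rewrite (integral_blockW_row (fun k => - b k)%R) margX_blockW stepFE.
  by rewrite mulNr -EFinM -EFinD subrr.
- under eq_integral do rewrite stepFE blockW_sym.
  rewrite (integral_blockW_row b) margY_blockW stepFE.
  by rewrite -EFinM -EFinD mulNr addNr.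
- under eq_integral do rewrite stepFE margY_blockW -EFinM mulNr.
  rewrite (integral_unit_fibers measurable_truncn (@leb_truncn_fiber R)
    (v := fun k => - (b k * c k))%R).
  + exact: sum_blocks_eq0.
  + by rewrite mul0r oppr0.
  + under eq_eseriesr do rewrite normrN normrM (ger0_norm (zero_at0_ge0 _)).
    exact: sum_blocks_ltpinfty.
Qed.

Lemma eq_powR_on_diag r (h : R * R -> R) (u : nat -> R) :
  (forall z, diag_label z <> 0%N -> h z = u (diag_label z)) ->
  (forall z, `|h z| `^ r * c (diag_label z) =
    `|u (diag_label z)| `^ r * c (diag_label z))%R.
Proof.
move=> hu z; have [->|/eqP/hu ->//] := eqVneq (diag_label z) 0%N.
by rewrite !mulr0.
Qed.

Lemma diag_labelP z : diag_label z <> 0%N ->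
  Num.truncn (z.1 : R) = diag_label z /\ Num.truncn (z.2 : R) = diag_label z.
Proof. by rewrite /diag_label; case: eqP. Qed.

End block_weight.

Lemma solves0 {R : realType} (w : R * R -> \bar R) :
  solves w (fun=> 0%R) (fun=> 0%R).
Proof.
split=> [x|y|]; rewrite ?mul0e ?add0e.
all: by apply: integral0_eq => z _; rewrite mul0e.
Qed.


Theorem mainTheorem5 (R : realType) (theta a : nat -> R)
    (theta_gt0 : forall i, (1 <= i)%N -> (0 < theta i)%R)
    (theta_sum : \sum_(1 <= i <oo) (theta i)%:E = 1)
    (a_L1 : \sum_(2 <= i <oo) (`|a i| * theta i)%:E < +oo)
    (a_notL2 : \sum_(2 <= i <oo) (`|a i| ^+ 2 * theta i)%:E = +oo)
    (a1 : a 1%N = (- ((theta 1%N)^-1 *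
                      \big[+%R/0%R]_(2 <= i <oo) (a i * theta i)))%R) :
  let w : R * R -> \bar R := blockW theta in
  let f : R -> R := stepF a in
  let g : R -> R := fun y => (- f y)%R in
  let fX : R * R -> R := fun z => f z.1 in
  let gY : R * R -> R := fun z => g z.2 in
  (* integrability of f(x), g(y) and f(x) + g(y) *)
  [/\ LrW w 1 fX, LrW w 1 gY, ~ LrW w 2 fX, ~ LrW w 2 gY &
      LrW w 2 (fun z => fX z + gY z)%R] /\
  (* (f, g) is a solution, and so is (0, 0), from which it differs *)
  [/\ solves w f g, solves w (fun=> 0%R) (fun=> 0%R) &
      ~ (eqW w fX (fun=> 0%R) /\ eqW w gY (fun=> 0%R))] /\
  (* solutions are not unique in L^1(w) *)
  ~ (forall f1 g1 f2 g2 : R -> R,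
       LrW w 1 (fun z => f1 z.1) -> LrW w 1 (fun z => g1 z.2) ->
       LrW w 1 (fun z => f2 z.1) -> LrW w 1 (fun z => g2 z.2) ->
       solves w f1 g1 -> solves w f2 g2 ->
       eqW w (fun z => f1 z.1) (fun z => f2 z.1) /\
       eqW w (fun z => g1 z.2) (fun z => g2 z.2)) /\
  (* in \bar R, 0^-1 = +oo and 0 * +oo = 0 *)
  \int[leb2 R]_z ((margX w z.1) ^+ 2 * (margY w z.2) ^+ 2 / w z) = +oo.
Proof.

move=> w f g fX gY.
have fE z : diag_label z <> 0%N -> fX z = zero_at0 a (diag_label z).
  by move=> /diag_labelP[z1 _]; rewrite /fX /f stepFE z1.
have gE z : diag_label z <> 0%N -> gY z = (- zero_at0 a (diag_label z))%R.
  by move=> /diag_labelP[_ z2]; rewrite /gY /g /f stepFE z2.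
have mf : measurable_fun setT
    (fX : measurableTypeR R * measurableTypeR R -> R).
  exact: measurableT_comp (measurable_stepF a) measurable_fst.
have mg : measurable_fun setT
    (gY : measurableTypeR R * measurableTypeR R -> R).
  apply: (measurableT_comp (@oppr_measurable R setT)).
  exact: measurableT_comp (measurable_stepF a) measurable_snd.
have sumfin := sum_blocks_ltpinfty theta_gt0 a_L1.
have suminf :
    \sum_(1 <= k <oo) (`|zero_at0 a k| `^ 2 * zero_at0 theta k)%:E = +oo.
  rewrite nneseries_recl1 => [|k]; last first.
    by rewrite mulr_ge0 ?zero_at0_ge0 ?powR_ge0.
  rewrite (_ : limn _ = +oo) ?addey// -a_notL2.
  apply/congr_lim/funext => n; apply: eq_big_nat => -[|k]// _ /=.
  by rewrite powR_mulrn.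
(* Only [|u k|] matters, so f and g are treated together, with [u] equal to the coefficients or
   their negatives. *)
have L1 h u :
    measurable_fun setT (h : measurableTypeR R * measurableTypeR R -> R) ->
    (forall z, diag_label z <> 0%N -> h z = u (diag_label z)) ->
    (forall k, `|u k| = `|zero_at0 a k|)%R -> LrW w 1 h.
  move=> mh hu ub; split=> //.
  rewrite (@integral_powR_blockW _ theta _ _
    (fun k => `|zero_at0 a k| * zero_at0 theta k)%R) //.
  - by move=> z; rewrite (eq_powR_on_diag _ _ hu) powRr1// ub.
  - by rewrite mulr0.
  - by move=> k; rewrite mulr_ge0// zero_at0_ge0.
have nL2 h u :
    measurable_fun setT (h : measurableTypeR R * measurableTypeR R -> R) ->
    (forall z, diag_label z <> 0%N -> h z = u (diag_label z)) ->
    (forall k, `|u k| = `|zero_at0 a k|)%R -> ~ LrW w 2 h.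
  move=> mh hu ub [_].
  rewrite (@integral_powR_blockW _ theta _ _
    (fun k => `|zero_at0 a k| `^ 2 * zero_at0 theta k)%R).
  - by rewrite suminf.
  - by move=> z; rewrite (eq_powR_on_diag _ _ hu) ub.
  - by rewrite mulr0.
  - by move=> k; rewrite mulr_ge0 ?zero_at0_ge0 ?powR_ge0.
(* Covers f(x) + g(y) with r = 2 and the zero function with r = 1. The case r = 0 is excluded
   because 0 to the power 0 is 1. *)
have L0 r h :
    measurable_fun setT (h : measurableTypeR R * measurableTypeR R -> R) ->
    r != 0%R -> (forall z, diag_label z <> 0%N -> h z = 0%R) -> LrW w r h.
  move=> mh r0 h0; split=> //.
  rewrite (@integral_powR_blockW _ theta _ _ (fun=> 0%R)) //.
  - by rewrite (@eseries0 _ (fun=> 0)).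
  - move=> z; rewrite (eq_powR_on_diag _ (u := fun=> 0%R) _ h0).
    by rewrite normr0 powR0// mul0r.
have solf : solves w f g by exact: solves_blockW.
have nontriv : ~ (eqW w fX (fun=> 0%R) /\ eqW w gY (fun=> 0%R)).
  move=> [f0 _].
  (* If all these coefficients vanished, the divergent series of squares would be 0. Then f is
     non-zero on the whole k-th square. *)
  have [k [k2 ak]] : exists k, (2 <= k)%N /\ a k <> 0%R.
    apply: contrapT => nk; suff : (0 : \bar R) = +oo by [].
    rewrite -a_notL2 eseries0// => k k2 _.
    have -> : a k = 0%R by apply: contrapT => ak; apply: nk; exists k.
    by rewrite normr0 expr0n mul0r.
  apply: (eqW_blockW theta_gt0 f0 (ltnW k2)) => z zk.
  rewrite fE zk; last by move=> k0; rewrite k0 in k2.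
  by case: k k2 ak {zk}.
have Lf : LrW w 1 fX by exact: (L1 _ (zero_at0 a)).
have Lg : LrW w 1 gY.
  by apply: (L1 _ (fun k => - zero_at0 a k)%R) => // k; rewrite normrN.
split.
  split; [exact: Lf|exact: Lg| | |].
  - exact: (nL2 _ (zero_at0 a)).
  - by apply: (nL2 _ (fun k => - zero_at0 a k)%R) => // k; rewrite normrN.
  - apply: L0 => //; first exact: measurable_funD.
    by move=> z z0; rewrite fE// gE// subrr.
have sol0 := solves0 w.
split; first by split; [exact: solf|exact: sol0|exact: nontriv].
split; last exact: integral_margins_over_blockW.
have L00 : LrW w 1 (fun=> 0%R) by apply: L0; rewrite ?oner_neq0.
(* Uniqueness would identify (f, g) with the zero solution, both being in L^1(w). *)
move=> uniq; apply: nontriv.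
exact: (uniq f g (fun=> 0%R) (fun=> 0%R) Lf Lg L00 L00 solf sol0).
Qed.
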